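(* Let $\nu\in(0,1)$ and, for $\omega\in(0,2)$, let $\eta_\nu(\omega)=\max\{|1-\omega|,\ \nu\omega^2\}$. Then the parameter which minimizes $\eta_\nu(\omega)$ over $\omega\in(0,2)$ is $$\omega^*_{aopt}(\nu)=\frac{\sqrt{4\nu+1}-1}{2\nu}.$$ *)

(* Defs.v *)
From mathcomp Require Import all_boot all_order all_algebra.
From mathcomp Require Import reals.
Set Implicit Arguments.
Unset Strict Implicit.
Unset Printing Implicit Defensive.
Import Order.TTheory GRing.Theory Num.Theory.
Local Open Scope ring_scope.

Definition eta (R : realType) (nu omega : R) : R :=
  Num.max `|1 - omega| (nu * omega ^+ 2).

Definition is_minimizer_on (R : realType) (D : interval R) (f : R -> R)
    (x : R) : Prop :=
  x \in D /\ (forall y : R, y \in D -> f x <= f y).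

Definition omega_aopt (R : realType) (nu : R) : R :=
  (Num.sqrt (4 * nu + 1) - 1) / (2 * nu).

(* Main.v *)
Require Import Defs.
From mathcomp Require Import all_boot all_order all_algebra.
From mathcomp Require Import reals.
From mathcomp Require Import ring lra.
Set Implicit Arguments.
Unset Strict Implicit.
Unset Printing Implicit Defensive.
Import Order.TTheory GRing.Theory Num.Theory.
Local Open Scope ring_scope.

(** The optimal parameter [w] is the positive root of [nu * w ^+ 2 = 1 - w]
    ([omega_aopt_balance]), the point where the two branches of [eta nu] cross.
    It lies in ]0, 1[, so the common value there is [1 - w].  To the left of
    the crossing the branch [`|1 - y|] exceeds this value, since it is at least
    [1 - y]; to the right the branch [nu * y ^+ 2] exceeds it, being increasing
    on positive arguments.  Hence [w] is a strict minimizer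
    ([eta_gt_balance]), which gives both optimality and uniqueness. *)

Lemma omega_aopt_gt0 (R : realType) (nu : R) : 0 < nu -> 0 < omega_aopt nu.
Proof.
move=> nu0; rewrite /omega_aopt divr_gt0 ?mulr_gt0// subr_gt0.
by rewrite -[ltLHS]sqrtr1 ltr_sqrt; lra.
Qed.

Lemma omega_aopt_balance (R : realType) (nu : R) : 0 < nu ->
  nu * omega_aopt nu ^+ 2 = 1 - omega_aopt nu.
Proof.
move=> nu0; rewrite /omega_aopt; set s := Num.sqrt _.
have s2 : s ^+ 2 = 4 * nu + 1 by rewrite sqr_sqrtr//; lra.
(* The difference of the two sides is (s ^+ 2 - (4 * nu + 1)) / (4 * nu). *)
apply/eqP; rewrite -subr_eq0; apply/eqP.
transitivity ((s ^+ 2 - (4 * nu + 1)) / (4 * nu)); last by rewrite s2 subrr mul0r.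
by field; rewrite gt_eqF.
Qed.

Lemma eta_balance (R : realType) (nu w : R) : 0 < nu ->
  nu * w ^+ 2 = 1 - w -> eta nu w = 1 - w.
Proof.
move=> nu0 balw; rewrite /eta balw ger0_norm ?maxxx// -balw.
by rewrite mulr_ge0 ?sqr_ge0// ltW.
Qed.

Lemma eta_gt_balance (R : realType) (nu w y : R) : 0 < nu -> 0 < w ->
  nu * w ^+ 2 = 1 - w -> y != w -> eta nu w < eta nu y.
Proof.
move=> nu0 w0 balw; rewrite eta_balance// /eta lt_max neq_lt => /orP[yw|wy].
  by rewrite (lt_le_trans _ (ler_norm _)) ?ltrD2l ?ltrN2.
by rewrite -balw ltr_pM2l// ltr_pXn2r ?wy ?orbT// nnegrE ltW// (lt_trans w0).
Qed.

Theorem mainTheorem3 (R : realType) (nu : R) (hnu : nu \in `]0, 1[) :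
  forall omega : R,
    is_minimizer_on `]0, 2[ (eta nu) omega <-> omega = omega_aopt nu.
Proof.
move=> omega; have nu0 : 0 < nu by move: hnu; rewrite in_itv => /andP[].
have w0 := omega_aopt_gt0 nu0; have balw := omega_aopt_balance nu0.
have eta_gt y := @eta_gt_balance _ _ _ y nu0 w0 balw.
have wD : omega_aopt nu \in `]0, 2[.
  rewrite in_itv /= w0 /=.
  (* The balance equation makes 1 - omega_aopt nu positive. *)
  have : 0 < nu * omega_aopt nu ^+ 2 by rewrite mulr_gt0 ?exprn_gt0.
  by rewrite balw; lra.
split=> [[_ omega_min]|->].
  by apply: contraTeq (omega_min _ wD) => /eta_gt; rewrite -ltNge.
by split=> // y _; have [->//|/eta_gt/ltW] := eqVneq y (omega_aopt nu).
Qed.
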